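(* Let $S$ be a spacelike surface immersed in a 4-dimensional Lorentzian manifold $(\mathcal V,g)$. The following conditions are equivalent: (i) $S$ is umbilical along a normal direction; (ii) two independent Weingarten operators commute, i.e. at each $x\in S$ there are linearly independent $M,N\in T_xS^\perp$ with $[A_M,A_N]=0$; (iii) all Weingarten operators commute, i.e. at each $x\in S$ one has $[A_M,A_N]=0$ for all $M,N\in T_xS^\perp$. Moreover, when these conditions hold, the umbilical direction is uniquely determined unless $S$ is totally umbilical: at each $x\in S$ at which $S$ is not totally umbilical, the nonzero vector $N\in T_xS^\perp$ along which $x$ is umbilical is unique up to multiplication by a nonzero real number.
   Context: $(\mathcal V,g)$ is a 4-dimensional, oriented and time-oriented Lorentzian manifold of signature $(-,+,+,+)$ with Levi-Civita connection $\nabla$. $S$ is an immersed 2-dimensional surface, identified locally with its image (considerations are local, so $S$ may be taken embedded and oriented), which is spacelike: the induced metric $\bar g$ is positive definite. For $x\in S$, $T_x\mathcal V=T_xS\oplus T_xS^\perp$, and superscripts $T$ and $\perp$ denote tangential and normal components. For a normal vector field $N$, the Weingarten operator is $A_N(X)=(\nabla_XN)^T$ for $X$ tangent to $S$; at each point it is a self-adjoint endomorphism of $T_xS$ depending only, and linearly, on $N|_x\in T_xS^\perp$. The shape tensor is $\mathrm{II}(X,Y)=-(\nabla_XY)^\perp$ (note the sign), so that $\bar g(A_N(X),Y)=g(N,\mathrm{II}(X,Y))$. The mean curvature vector $H$ is the trace of $\mathrm{II}$ with respect to $\bar g$, so $\mathrm{tr}A_N=g(H,N)$. A point $x\in S$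 is umbilical along $N\in T_xS^\perp$ if $A_N|_x=\frac12 g(H,N)\,\mathbf 1$. $S$ is umbilical along a normal direction if for each $x\in S$ there is a nonzero $N\in T_xS^\perp$ along which $x$ is umbilical. $S$ is totally umbilical at $x$ if $x$ is umbilical along every $N\in T_xS^\perp$. *)

(* Defs.v *)
From HB Require Import structures.
From mathcomp Require Import all_boot all_order all_algebra.
From mathcomp Require Import all_classical all_reals all_analysis.

Set Implicit Arguments.
Unset Strict Implicit.
Unset Printing Implicit Defensive.

Import Order.TTheory GRing.Theory Num.Theory.
Import numFieldNormedType.Exports.
Local Open Scope classical_set_scope.
Local Open Scope ring_scope.

Section Smooth.
Context {R : realType} {V W : normedModType R}.

(* iter_derive [:: v1; ...; vk] h = D_v1 (... (D_vk h)) *)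
Definition iter_derive (vs : seq V) (h : V -> W) : V -> W :=
  foldr (fun v k x => 'D_v k x) h vs.

(* C^oo on U; only used for open U, so that only the values of h on U matter. *)
Definition smooth_on (U : set V) (h : V -> W) : Prop :=
  forall vs x, U x -> differentiable (iter_derive vs h) x.

End Smooth.

Record chart (R : realType) (n : nat) (M : topologicalType) := Chart {
  cdom : set M;
  cimg : set 'rV[R]_n;
  cmap :> M -> 'rV[R]_n;
  cinv : 'rV[R]_n -> M;
  cdom_open : open cdom;
  cimg_open : open cimg;
  cmap_img : forall p, cdom p -> cimg (cmap p);
  cinv_dom : forall u, cimg u -> cdom (cinv u);
  cmapK : forall p, cdom p -> cinv (cmap p) = p;
  cinvK : forall u, cimg u -> cmap (cinv u) = u;
  cmap_cont : {within cdom, continuous cmap};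
  cinv_cont : {within cimg, continuous cinv} }.

(* Coordinate change c -> d, meaningful on the open set overlap c d. *)
Definition transition (R : realType) n (M : topologicalType)
    (c d : chart R n M) : 'rV[R]_n -> 'rV[R]_n := d \o cinv c.

Definition overlap (R : realType) n (M : topologicalType)
    (c d : chart R n M) : set 'rV[R]_n := cimg c `&` cinv c @^-1` cdom d.

Record smooth_manifold (R : realType) (n : nat) := SmoothManifold {
  msort :> topologicalType;
  m_hausdorff : hausdorff_space msort;
  m_second_countable : @second_countable msort;
  atlas : Type;
  achart : atlas -> chart R n msort;
  atlas_cover : forall p, exists i, cdom (achart i) p;
  atlas_smooth : forall i j,
    smooth_on (overlap (achart i) (achart j))
              (transition (achart i) (achart j)) }.

(* A chart index around p, fixed once and for all; the tangent space at p is
   'rV[R]_n, read through the coordinate frame of that chart. *)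
Definition chart_at (R : realType) n (M : smooth_manifold R n) (p : M) :
  atlas M := projT1 (cid (atlas_cover p)).

Definition ip (R : realType) n (G : 'M[R]_n) (v w : 'rV[R]_n) : R :=
  (v *m G *m w^T) 0 0.

Definition minkowski (R : realType) : 'M[R]_4 :=
  diag_mx (\row_(k < 4) (if k == 0 then -1 else 1)).

Definition lorentzian (R : realType) (G : 'M[R]_4) : Prop :=
  G^T = G /\ exists2 P, P \in unitmx & P *m G *m P^T = minkowski R.

(* lmetric i u is the Gram matrix of the metric in the frame of the chart i at
   the point with coordinates u; likewise for the time orientation ltime. *)
Record lorentzian_manifold (R : realType) := LorentzianManifold {
  lsort :> smooth_manifold R 4;
  l_oriented : forall (i j : atlas lsort) u,
    overlap (achart i) (achart j) u ->
    0 < \det (jacobian (transition (achart i) (achart j)) u);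
  lmetric : atlas lsort -> 'rV[R]_4 -> 'M[R]_4;
  lmetric_smooth : forall i, smooth_on (cimg (achart i)) (lmetric i);
  lmetric_lorentzian : forall i u,
    cimg (achart i) u -> lorentzian (lmetric i u);
  lmetric_tensor : forall i j u, overlap (achart i) (achart j) u ->
    forall v w, ip (lmetric i u) v w =
      ip (lmetric j (transition (achart i) (achart j) u))
         ('d (transition (achart i) (achart j)) u v)
         ('d (transition (achart i) (achart j)) u w);
  ltime : atlas lsort -> 'rV[R]_4 -> 'rV[R]_4;
  ltime_smooth : forall i, smooth_on (cimg (achart i)) (ltime i);
  ltime_timelike : forall i u, cimg (achart i) u ->
    ip (lmetric i u) (ltime i u) (ltime i u) < 0;
  ltime_vector : forall i j u, overlap (achart i) (achart j) u ->
    'd (transition (achart i) (achart j)) u (ltime i u) =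
      ltime j (transition (achart i) (achart j) u) }.

(* Christoffel symbol Gamma^k_ij of the Levi-Civita connection of G. *)
Definition christoffel (R : realType) n (G : 'rV[R]_n -> 'M[R]_n)
    (p : 'rV[R]_n) (i j k : 'I_n) : R :=
  2^-1 * \sum_l invmx (G p) k l *
    ('D_(delta_mx 0 i) (fun q => G q j l : R) p
     + 'D_(delta_mx 0 j) (fun q => G q i l : R) p
     - 'D_(delta_mx 0 l) (fun q => G q i j : R) p).

(* (nabla_X F)(u), the covariant derivative of a vector field F along a map
   phi, for the Levi-Civita connection of G, in coordinates. *)
Definition cov (R : realType) m n (G : 'rV[R]_n -> 'M[R]_n)
    (phi F : 'rV[R]_m -> 'rV[R]_n) (X u : 'rV[R]_m) : 'rV[R]_n :=
  'D_X F u + \row_k \sum_i \sum_j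
    christoffel G (phi u) i j k * ('d phi u X) 0 i * F u 0 j.

Section Surface.
Context {R : realType} {V : lorentzian_manifold R} {S : smooth_manifold R 2}.
Variable f : S -> V.

Definition coord_rep (i : atlas V) (j : atlas S) : 'rV[R]_2 -> 'rV[R]_4 :=
  achart i \o f \o cinv (achart j).

Definition immersion : Prop :=
  continuous f /\
  forall (i : atlas V) (j : atlas S),
    let D := cimg (achart j) `&`
             (f \o cinv (achart j)) @^-1` cdom (achart i) in
    smooth_on D (coord_rep i j) /\
    (forall u, D u -> injective ('d (coord_rep i j) u)).

Definition spacelike : Prop :=
  forall (i : atlas V) (j : atlas S) (u : 'rV[R]_2),
    cimg (achart j) u -> cdom (achart i) (f (cinv (achart j) u)) ->
    forall X, X != 0 ->
      0 < ip (lmetric i (coord_rep i j u))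
             ('d (coord_rep i j) u X) ('d (coord_rep i j) u X).

Section AtPoint.
Variable x : S.

Definition pt : 'rV[R]_2 := achart (chart_at x) x.
Definition loc : 'rV[R]_2 -> 'rV[R]_4 := coord_rep (chart_at (f x)) (chart_at x).
Definition locmetric : 'rV[R]_4 -> 'M[R]_4 := lmetric (chart_at (f x)).

(* The metric on the tangent space of V at the image of u, for u near pt. *)
Definition gat (u : 'rV[R]_2) (v w : 'rV[R]_4) : R := ip (locmetric (loc u)) v w.

Definition normal_at (u : 'rV[R]_2) (N : 'rV[R]_4) : Prop :=
  forall X, gat u N ('d loc u X) = 0.

Definition normal (N : 'rV[R]_4) : Prop := normal_at pt N.

(* v = 'd loc pt (tang v) + perp v; tangent vectors of S at x are represented
   by their components 'rV[R]_2 rather than by their images in T V. *)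
Definition tang (v : 'rV[R]_4) : 'rV[R]_2 :=
  xget 0 [set Y | normal (v - 'd loc pt Y)].

Definition perp (v : 'rV[R]_4) : 'rV[R]_4 := v - 'd loc pt (tang v).

Definition nabla (F : 'rV[R]_2 -> 'rV[R]_4) (X : 'rV[R]_2) : 'rV[R]_4 :=
  cov locmetric loc F X pt.

Definition normal_field (F : 'rV[R]_2 -> 'rV[R]_4) : Prop :=
  exists U, [/\ open U, U pt, smooth_on U F & forall u, U u -> normal_at u (F u)].

Definition weingarten_field (F : 'rV[R]_2 -> 'rV[R]_4) (X : 'rV[R]_2) :
  'rV[R]_2 := tang (nabla F X).

(* Some smooth normal field near x with value N at x; the resulting Weingarten
   operator does not depend on which one. *)
Definition normal_extension (N : 'rV[R]_4) : 'rV[R]_2 -> 'rV[R]_4 :=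
  xget (fun=> N) [set F | normal_field F /\ F pt = N].

Definition weingarten (N : 'rV[R]_4) (X : 'rV[R]_2) : 'rV[R]_2 :=
  weingarten_field (normal_extension N) X.

(* II(X, Y) = - (nabla_X Y)^perp is tensorial in Y, which is extended here with
   constant components in the coordinate frame of S. *)
Definition shape (X Y : 'rV[R]_2) : 'rV[R]_4 :=
  - perp (nabla (fun u => 'd loc u Y) X).

Definition induced_metric : 'M[R]_2 :=
  \matrix_(a, b) gat pt ('d loc pt (delta_mx 0 a)) ('d loc pt (delta_mx 0 b)).

Definition mean_curvature : 'rV[R]_4 :=
  \sum_a \sum_b invmx induced_metric a b *: shape (delta_mx 0 a) (delta_mx 0 b).

Definition umbilical_along (N : 'rV[R]_4) : Prop :=
  normal N /\
  forall X, weingarten N X = (2^-1 * gat pt mean_curvature N) *: X.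

Definition totally_umbilical : Prop :=
  forall N, normal N -> umbilical_along N.

Definition weingarten_commute (M N : 'rV[R]_4) : Prop :=
  forall X, weingarten M (weingarten N X) = weingarten N (weingarten M X).

End AtPoint.

Definition umbilical_along_normal_direction : Prop :=
  forall x, exists2 N, N != 0 & umbilical_along x N.

Definition two_weingarten_commute : Prop :=
  forall x, exists M N, [/\ normal x M, normal x N, free [:: M; N] &
                            weingarten_commute x M N].

Definition all_weingarten_commute : Prop :=
  forall x M N, normal x M -> normal x N -> weingarten_commute x M N.

Definition umbilical_direction_unique (x : S) : Prop :=
  exists N, [/\ N != 0, umbilical_along x N &
    forall N', N' != 0 -> umbilical_along x N' ->
      exists2 c : R, c != 0 & N' = c *: N].

End Surface.

(* Main.v *)
Require Import Defs.
From HB Require Import structures.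
From mathcomp Require Import all_boot all_order all_algebra.
From mathcomp Require Import all_classical all_reals all_analysis.
From mathcomp Require Import ring.

(** The whole statement is linear algebra at one point x, once the Weingarten
    operators there are known to depend linearly on the normal vector.

    Differentiating g(F, e) = 0 for a normal field F and a tangent field e, and
    using that the connection is metric, gives
    [g(A_N X, e) = - g(N, nabla_X e)] (lemma [nabla_normal_tangential]).  The
    right-hand side sees only the value N of F at x and is linear in N and in X,
    so A_N is right multiplication by a matrix [weingarten_mx N] linear in N
    (lemmas [weingartenE], [weingarten_mx_linear]).  The same formula with the
    definition of the mean curvature H gives [g(H, N) = tr A_N], so that N is
    umbilical exactly when A_N is a scalar matrix ([umbilical_alongP]).

    The normal space is a plane, as the kernel of a matrix of rank 2
    ([rank_normal]).  Hence the three conditions compare as follows.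
    - If A_N is scalar for some N <> 0, complete N to a basis (N, L) of the
      normal plane: every Weingarten operator is a scalar plus a multiple of
      A_L, and such operators commute ([scalar_direction_comm]).
    - Two commuting 2 x 2 matrices have proportional trace-free parts, because
      the commutator on trace-free 2 x 2 matrices is, up to scaling of the
      coordinates, a cross product.  So if A_M and A_N commute for independent
      M and N, some nontrivial combination of them is scalar, and this is
      A_L for the corresponding L <> 0 ([comm_mx2_dependent],
      [comm_scalar_direction]).
    - Two independent umbilical directions span the normal plane and make every
      Weingarten operator scalar ([two_scalar_directions]), whence the
      uniqueness away from totally umbilical points.

    Since [weingarten] is defined through a chosen smooth normal extension, one
    has to exhibit one: the orthogonal projection of a constant field onto the
    normal spaces ([normal_part]).  Its coefficients are rational expressions in
    the metric along the surface and in the first derivatives of the immersion,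
    so its smoothness rests on the closure of smooth functions under sums,
    products, quotients and composition. *)

Set Implicit Arguments.
Unset Strict Implicit.
Unset Printing Implicit Defensive.

Import Order.TTheory GRing.Theory Num.Theory.
Import numFieldNormedType.Exports.
Local Open Scope classical_set_scope.
Local Open Scope ring_scope.

(** * Calculus of smooth functions *)

Lemma near_eq_differentiable (R : realType) (V W : normedModType R)
    (f g : V -> W) (x : V) :
  {near x, f =1 g} -> differentiable f x -> differentiable g x.
Proof.
move=> fg /diff_locallyP[cdf /eqaddoP df].
have gx : f x = g x by exact: nbhs_singleton fg.
have H : g \o shift x = cst (g x) + 'd f x +o_ 0 id.
  have fg0 : {near 0, f \o shift x =1 g \o shift x}.
    by move: fg; rewrite {1}(near_shift 0 x) subr0.
  apply/eqaddoP => e e0; move: fg0 (df e e0).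
  by apply: filterS2 => h /= fgh; rewrite !fctE -gx -fgh.
have dE : 'd g x = 'd f x :> (V -> W) by exact: (diff_unique cdf H).
by apply/diff_locallyP; rewrite dE.
Qed.

Section Diffn.
Context {R : realType} {V : normedModType R}.
Implicit Type U : set V.

(** The induction-friendly form of k + 1 times differentiable on U: the
    directional derivatives are peeled off from the inside, so that each
    closure property follows from its first-order differentiation rule by
    induction on k. *)
Fixpoint diffn {W : normedModType R} (k : nat) U (h : V -> W) : Prop :=
  (forall x, U x -> differentiable h x) /\
  if k is k'.+1 then forall v, diffn k' U (fun x => 'D_v h x) else True.

Lemma iter_derive_rcons (W : normedModType R) (vs : seq V) v (h : V -> W) :
  iter_derive (rcons vs v) h = iter_derive vs (fun x => 'D_v h x).
Proof. by rewrite /iter_derive foldr_rcons. Qed.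

Lemma smooth_onP (W : normedModType R) U (h : V -> W) :
  smooth_on U h <-> forall k, diffn k U h.
Proof.
split=> [hs k|hs vs].
  elim: k h hs => [|k IH] h hs /=; split=> //; try by exact: (hs [::]).
  by move=> v; apply: IH => vs x Ux; rewrite -iter_derive_rcons; exact: hs.
elim/last_ind: vs h hs => [|vs v IH] h hs x Ux; first
  by have [+ _] := hs 0; exact.
by rewrite iter_derive_rcons; apply: IH => // k; have [_ +] := hs k.+1; exact.
Qed.

Lemma diffn_differentiable (W : normedModType R) k U (h : V -> W) x :
  U x -> diffn k U h -> differentiable h x.
Proof. by move=> Ux; case: k => [|k] [+ _]; exact. Qed.

Lemma diffnW (W : normedModType R) k U (h : V -> W) :
  diffn k.+1 U h -> diffn k U h.
Proof.
elim: k h => [|k IH] h [dh Dh]; split=> // v.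
by apply: IH; exact: Dh.
Qed.

Variable U : set V.
Hypothesis oU : open U.

Lemma open_near_eq (W : Type) (f g : V -> W) x :
  {in U, f =1 g} -> U x -> {near x, f =1 g}.
Proof.
move=> fg Ux; near=> y; apply: fg; rewrite inE.
by near: y; exact: open_nbhs_nbhs.
Unshelve. all: by end_near. Qed.

Lemma diffn_eq (W : normedModType R) k (f g : V -> W) :
  {in U, f =1 g} -> diffn k U f -> diffn k U g.
Proof.
elim: k f g => [|k IH] f g fg [df Df];
    have dg x : U x -> differentiable g x
      by move=> Ux; apply: near_eq_differentiable (df _ Ux); exact: open_near_eq.
  by [].
split=> // v; apply: IH (Df v) => x /set_mem Ux.
by apply: near_eq_derive; exact: open_near_eq.
Qed.

Lemma diffn_cst (W : normedModType R) k (c : W) : diffn k U (fun=> c).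
Proof.
elim: k c => [|k IH] c /=; split=> // v.
by apply: diffn_eq (IH 0) => x _; rewrite derive_cst.
Qed.

Lemma diffnD (W : normedModType R) k (f g : V -> W) :
  diffn k U f -> diffn k U g -> diffn k U (fun x => f x + g x).
Proof.
elim: k f g => [|k IH] f g [df Df] [dg Dg];
    have dfg x : U x -> differentiable (fun y => f y + g y) x
      by move=> Ux; apply: differentiableD; [exact: df|exact: dg].
  by [].
split=> // v; apply: diffn_eq (IH _ _ (Df v) (Dg v)) => x /set_mem Ux.
by rewrite deriveD//; apply: diff_derivable; [exact: df|exact: dg].
Qed.

Lemma diffn_sum (W : normedModType R) k (I : Type) (r : seq I) (P : pred I)
    (f : I -> V -> W) :
  (forall i, diffn k U (f i)) -> diffn k U (fun x => \sum_(i <- r | P i) f i x).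
Proof.
move=> df; elim: r => [|i r IH].
  by apply: diffn_eq (diffn_cst k 0) => x _; rewrite big_nil.
apply: (@diffn_eq _ _ (fun x => (if P i then f i x else 0) +
                          \sum_(j <- r | P j) f j x)).
  by move=> x _; rewrite big_cons; case: ifP => _; rewrite ?add0r.
by apply: diffnD => //; case: (P i); [exact: df|exact: diffn_cst].
Qed.

Lemma diffnM k (f g : V -> R) :
  diffn k U f -> diffn k U g -> diffn k U (fun x => f x * g x).
Proof.
elim: k f g => [|k IH] f g df dg;
    have dfg x : U x -> differentiable (fun y => f y * g y) x
      by move=> Ux; apply: differentiableM;
        [exact: diffn_differentiable df|exact: diffn_differentiable dg].
  by [].
split=> // v; apply: (@diffn_eq _ _ (fun x => f x * 'D_v g x + g x * 'D_v f x)).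
  move=> x /set_mem Ux; rewrite deriveM//; apply: diff_derivable;
  [exact: diffn_differentiable df|exact: diffn_differentiable dg].
by apply: diffnD; apply: IH;
  [exact: diffnW|exact: (dg.2 v)|exact: diffnW|exact: (df.2 v)].
Qed.

Lemma diffnN k (f : V -> R) : diffn k U f -> diffn k U (fun x => - f x).
Proof.
move=> df; apply: (@diffn_eq _ _ (fun x => -1 * f x)).
  by move=> x _; rewrite mulN1r.
by apply: diffnM => //; exact: diffn_cst.
Qed.

Lemma diffn_prod k (I : Type) (r : seq I) (P : pred I) (f : I -> V -> R) :
  (forall i, diffn k U (f i)) ->
  diffn k U (fun x => \prod_(i <- r | P i) f i x).
Proof.
move=> df; elim: r => [|i r IH].
  by apply: diffn_eq (diffn_cst k (1 : R)) => x _; rewrite big_nil.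
apply: (@diffn_eq _ _ (fun x => (if P i then f i x else 1) *
                          \prod_(j <- r | P j) f j x)).
  by move=> x _; rewrite big_cons; case: ifP => _; rewrite ?mul1r.
by apply: diffnM => //; case: (P i); [exact: df|exact: diffn_cst].
Qed.

Lemma diffnV k (f : V -> R) : (forall x, U x -> f x != 0) ->
  diffn k U f -> diffn k U (fun x => (f x)^-1).
Proof.
move=> f0; elim: k => [|k IH] df;
    have dV x : U x -> differentiable (fun y => (f y)^-1) x
      by move=> Ux; apply: differentiableV;
        [exact: diffn_differentiable df|exact: f0].
  by [].
split=> // v.
apply: (@diffn_eq _ _ (fun x => - ('D_v f x * ((f x)^-1 * (f x)^-1)))).
  move=> x /set_mem Ux; rewrite deriveV//; last 2 first.
  - exact: f0.
  - by apply: diff_derivable; exact: diffn_differentiable df.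
  by rewrite scaleNr -[_ *: _]/(_ * _) mulrC expr2 invfM.
have dfV := IH (diffnW df).
by apply: diffnN; apply: diffnM; [exact: (df.2 v)|exact: diffnM].
Qed.

Lemma differentiable_mxP m n (M : V -> 'M[R]_(m, n)) x :
  differentiable M x <-> forall i j, differentiable (fun y => M y i j) x.
Proof.
split=> [dM i j|dM].
  exact: (differentiable_comp dM (differentiable_coord (M x) i j)).
have -> : M = \sum_i \sum_j fun y => M y i j *: (delta_mx i j : 'M[R]_(m, n)).
  apply/funext => y; rewrite [LHS]matrix_sum_delta fct_sumE.
  by apply: eq_bigr => i _; rewrite fct_sumE.
by do 2!apply: differentiable_sum => ?; exact: differentiableZl.
Qed.

Lemma diffn_mxP m n k (M : V -> 'M[R]_(m, n)) :
  diffn k U M <-> forall i j, diffn k U (fun x => M x i j).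
Proof.
elim: k M => [|k IH] M /=.
  split=> [[dM _] i j|dM].
    by split=> // x Ux; have /differentiable_mxP := dM _ Ux; exact.
  by split=> // x Ux; apply/differentiable_mxP => i j; exact: (dM i j).1.
split=> [[dM DM] i j|dM].
  split=> [x Ux|v]; first by have /differentiable_mxP := dM _ Ux; exact.
  have /IH/(_ i j) := DM v; apply: diffn_eq => x /set_mem Ux.
  by rewrite derive_mx ?mxE//; apply: diff_derivable; exact: dM.
have dM1 x : U x -> differentiable M x.
  by move=> Ux; apply/differentiable_mxP => i j; exact: (dM i j).1.
split=> // v; apply/IH => i j; apply: diffn_eq ((dM i j).2 v) => x /set_mem Ux.
by rewrite derive_mx ?mxE//; apply: diff_derivable; exact: dM1.
Qed.

Lemma diffn_mulmx m n p k (A : V -> 'M[R]_(m, n)) (B : V -> 'M[R]_(n, p)) :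
  diffn k U A -> diffn k U B -> diffn k U (fun x => A x *m B x).
Proof.
move=> /diffn_mxP dA /diffn_mxP dB; apply/diffn_mxP => i j.
apply: (@diffn_eq _ _ (fun x => \sum_l A x i l * B x l j)).
  by move=> x _; rewrite mxE.
by apply: diffn_sum => l; exact: diffnM.
Qed.

Lemma diffn_trmx m n k (A : V -> 'M[R]_(m, n)) :
  diffn k U A -> diffn k U (fun x => (A x)^T).
Proof.
move=> /diffn_mxP dA; apply/diffn_mxP => i j.
by apply: diffn_eq (dA j i) => x _; rewrite mxE.
Qed.

Lemma diffn_det n k (A : V -> 'M[R]_n) :
  diffn k U A -> diffn k U (fun x => \det (A x)).
Proof.
move=> /diffn_mxP dA; apply: diffn_sum => s.
by apply: diffnM; [exact: diffn_cst|exact: diffn_prod].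
Qed.

(** Smoothness passes to the inverse matrix by Cramer's formula, the entries of
    the adjugate being polynomial in those of the matrix. *)
Lemma diffn_invmx n k (A : V -> 'M[R]_n) :
  (forall x, U x -> A x \in unitmx) ->
  diffn k U A -> diffn k U (fun x => invmx (A x)).
Proof.
move=> uA dA; apply/diffn_mxP => i j.
apply: (@diffn_eq _ _ (fun x => (\det (A x))^-1 * cofactor (A x) j i)).
  by move=> x /set_mem Ux; rewrite /invmx uA// !mxE.
apply: diffnM.
  apply: diffnV; last exact: diffn_det.
  by move=> x Ux; rewrite -unitfE -unitmxE; exact: uA.
apply: diffnM; first exact: diffn_cst.
apply: diffn_det; apply/diffn_mxP => a b; move/diffn_mxP: dA.
by move=> /(_ (lift j a) (lift i b)); apply: diffn_eq => x _; rewrite !mxE.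
Qed.

End Diffn.

(** By the chain rule, the derivative of [h \o phi] along v is the sum of the
    products of the components of ['D_v phi] with the partial derivatives of h
    taken along phi; these are again composites, of order one less. *)
Lemma diffn_comp (R : realType) (V : normedModType R) n (U : set V)
    (U' : set 'rV[R]_n) k (phi : V -> 'rV[R]_n) (h : 'rV[R]_n -> R) :
  open U -> (forall x, U x -> U' (phi x)) ->
  diffn k U phi -> diffn k U' h -> diffn k U (h \o phi).
Proof.
move=> oU UU'; elim: k h => [|k IH] h dphi dh;
    have dc x : U x -> differentiable (h \o phi) x
      by move=> Ux; apply: differentiable_comp;
        [exact: diffn_differentiable dphi
        |apply: diffn_differentiable dh; exact: UU'].
  by [].
split=> // v; apply: (@diffn_eq _ _ U oU _ _
  (fun x => \sum_i ('D_v phi x) 0 i * ('D_(delta_mx 0 i) h (phi x)))).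
  move=> x /set_mem Ux.
  have dp : differentiable phi x by exact: diffn_differentiable dphi.
  have dhp : differentiable h (phi x).
    by apply: diffn_differentiable dh; exact: UU'.
  rewrite [RHS]deriveE; last exact: differentiable_comp.
  rewrite diff_comp//= -(deriveE _ dp) [X in 'd h _ X]row_sum_delta linear_sum.
  by apply: eq_bigr => i _; rewrite linearZ /= (deriveE _ dhp).
apply: diffn_sum => // i; apply: diffnM => //.
  by have /(diffn_mxP oU) := dphi.2 v; exact.
apply: (IH (fun y => 'D_(delta_mx 0 i) h y)); first exact: diffnW.
exact: (dh.2 (delta_mx 0 i)).
Qed.

(** * Metric compatibility of the Levi-Civita connection *)

Section MatrixDerive.
Context {R : realType} {V : normedModType R}.
Implicit Types x v : V.

Lemma is_derive_mxP m n (M : V -> 'M[R]_(m, n)) x v dM :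
  is_derive x v M dM <-> forall i j, is_derive x v (fun y => M y i j) (dM i j).
Proof.
split=> [[dMx <-] i j|dMx].
  have /derivable_mxP/(_ i j) dMij := dMx.
  by apply: DeriveDef => //; rewrite derive_mx// mxE.
have dM' : derivable M x v by apply/derivable_mxP => i j; have [] := dMx i j.
apply: DeriveDef => //; rewrite derive_mx//; apply/matrixP => i j.
by rewrite mxE; have [_ ->] := dMx i j.
Qed.

Lemma is_derive_mulmx m n p (A : V -> 'M[R]_(m, n)) (B : V -> 'M[R]_(n, p))
    x v dA dB :
  is_derive x v A dA -> is_derive x v B dB ->
  is_derive x v (fun y => A y *m B y) (dA *m B x + A x *m dB).
Proof.
move=> /is_derive_mxP dAx /is_derive_mxP dBx; apply/is_derive_mxP => i j.
have -> : (fun y => (A y *m B y) i j) =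
    \sum_l ((fun y => A y i l) * (fun y => B y l j)).
  by apply/funext => y; rewrite fct_sumE mxE.
apply: is_derive_eq; rewrite !mxE -big_split /=.
by apply: eq_bigr => l _; rewrite addrC -![_ *: _]/(_ * _) (mulrC (B x l j)).
Qed.

Lemma is_derive_trmx m n (A : V -> 'M[R]_(m, n)) x v dA :
  is_derive x v A dA -> is_derive x v (fun y => (A y)^T) dA^T.
Proof.
move=> /is_derive_mxP dAx; apply/is_derive_mxP => i j; rewrite mxE.
by have -> : (fun y => (A y)^T i j) = (fun y => A y j i) by
  apply/funext => y; rewrite mxE.
Qed.

End MatrixDerive.

Section MetricCompatibility.
Context {R : realType} {m n : nat}.
Variables (G : 'rV[R]_n -> 'M[R]_n) (phi : 'rV[R]_m -> 'rV[R]_n).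
Variables (X p : 'rV[R]_m).
Hypothesis dG : differentiable G (phi p).
Hypothesis dphi : differentiable phi p.
Hypothesis symG : \forall q \near phi p, (G q)^T = G q.
Hypothesis uG : G (phi p) \in unitmx.

(** The matrix of the connection form in the direction X, so that covariant
    differentiation along [phi] is the derivative plus a right multiplication. *)
Definition connection_mx : 'M[R]_n :=
  \matrix_(j, k) \sum_i christoffel G (phi p) i j k * ('d phi p X) 0 i.

Lemma covE (F : 'rV[R]_m -> 'rV[R]_n) :
  cov G phi F X p = 'D_X F p + F p *m connection_mx.
Proof.
rewrite /cov; congr (_ + _); apply/rowP => k; rewrite !mxE.
rewrite exchange_big; apply: eq_bigr => j _; rewrite !mxE mulr_sumr.
by apply: eq_bigr => i _; rewrite mulrC.
Qed.

Lemma christoffel_lower i j l :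
  \sum_k christoffel G (phi p) i j k * G (phi p) k l =
  2^-1 * ('D_(delta_mx 0 i) (fun q => G q j l : R) (phi p)
     + 'D_(delta_mx 0 j) (fun q => G q i l : R) (phi p)
     - 'D_(delta_mx 0 l) (fun q => G q i j : R) (phi p)).
Proof.
pose D a := 'D_(delta_mx 0 i) (fun q => G q j a : R) (phi p)
     + 'D_(delta_mx 0 j) (fun q => G q i a : R) (phi p)
     - 'D_(delta_mx 0 a) (fun q => G q i j : R) (phi p).
have symGp : forall a b, G (phi p) a b = G (phi p) b a.
  by move=> a b; rewrite -[in LHS](nbhs_singleton symG) mxE.
transitivity (2^-1 * \sum_a (G (phi p) *m invmx (G (phi p))) l a * D a).
  rewrite /christoffel mulr_sumr.
  under eq_bigr do rewrite -mulrA mulr_suml mulr_sumr.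
  rewrite exchange_big /=; apply: eq_bigr => a _.
  rewrite mxE mulr_suml mulr_sumr; apply: eq_bigr => k _.
  by rewrite (symGp l k) -/(D a); ring.
rewrite mulmxV// (bigD1 l)//= mxE eqxx mul1r big1 ?addr0// => a al.
by rewrite mxE eq_sym (negbTE al) mul0r.
Qed.

(** That [nabla G = 0]: the two terms are transposes of each other, so this is
    the symmetrization of the lowered Christoffel symbols in their last two
    indices, in which the derivatives of the metric with the wrong indices
    cancel by its symmetry.  This symmetry is needed on a neighbourhood, since
    it is the derivatives that are transposed. *)
Lemma connection_mx_compat :
  connection_mx *m G (phi p) + G (phi p) *m connection_mx^T =
  'D_('d phi p X) G (phi p).
Proof.
have symGp := nbhs_singleton symG.
have -> : G (phi p) *m connection_mx^T = (connection_mx *m G (phi p))^T.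
  by rewrite trmx_mul symGp.
have symD v a b : 'D_v (fun q => G q a b : R) (phi p) =
    'D_v (fun q => G q b a : R) (phi p).
  apply: near_eq_derive; apply: filterS symG => q symq.
  by rewrite -[in LHS]symq mxE.
have GE a b : (connection_mx *m G (phi p)) a b = \sum_i ('d phi p X) 0 i *
   (2^-1 * ('D_(delta_mx 0 i) (fun q => G q a b : R) (phi p)
     + 'D_(delta_mx 0 a) (fun q => G q i b : R) (phi p)
     - 'D_(delta_mx 0 b) (fun q => G q i a : R) (phi p))).
  rewrite mxE; under eq_bigr do rewrite mxE mulr_suml.
  rewrite exchange_big; apply: eq_bigr => i _ /=.
  rewrite -christoffel_lower mulr_sumr; apply: eq_bigr => k _; ring.
apply/matrixP => a b; rewrite mxE [X in _ + X]mxE !GE -big_split/=.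
rewrite deriveE// [X in 'd G _ X]row_sum_delta linear_sum summxE.
apply: eq_bigr => i _.
rewrite linearZ /= mxE -(deriveE _ dG) derive_mx; last exact: diff_derivable.
by rewrite [in RHS]mxE (symD _ b a); field.
Qed.

Lemma is_derive_ip (F K : 'rV[R]_m -> 'rV[R]_n) :
  derivable F p X -> derivable K p X ->
  is_derive p X (fun u => ip (G (phi u)) (F u) (K u))
    (ip (G (phi p)) (cov G phi F X p) (K p) +
     ip (G (phi p)) (F p) (cov G phi K X p)).
Proof.
move=> /derivableP dF /derivableP dK.
have dGphi : is_derive p X (fun u => G (phi u)) ('D_('d phi p X) G (phi p)).
  have dc : differentiable (G \o phi) p by exact: differentiable_comp.
  apply: DeriveDef; first exact: diff_derivable.
  by rewrite [LHS]deriveE// diff_comp//= deriveE.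
have dall := is_derive_mulmx (is_derive_mulmx dF dGphi) (is_derive_trmx dK).
have /is_derive_mxP/(_ 0 0) d := dall; apply: (is_derive_eq d).
rewrite /ip !covE -connection_mx_compat (linearD trmx) /= trmx_mul.
rewrite !(mulmxDl, mulmxDr) !mulmxA !mxE; ring.
Qed.

End MetricCompatibility.

(** * Commuting 2 x 2 matrices *)

Section LinearAlgebra.
Context {F : fieldType}.

Lemma ord2_cases (i : 'I_2) : i = 0 \/ i = 1.
Proof. by case: i => -[|[|//]] ?; [left|right]; exact: val_inj. Qed.

Lemma sum_ord2 (f : 'I_2 -> F) : \sum_k f k = f 0 + f 1.
Proof. by rewrite big_ord_recl big_ord1; congr (_ + f _); exact: val_inj. Qed.

Lemma mx2_is_scalar (A : 'M[F]_2) :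
  A 0 1 = 0 -> A 1 0 = 0 -> A 0 0 = A 1 1 -> A = (A 0 0)%:M.
Proof.
move=> A01 A10 A00; apply/matrixP => i j; rewrite mxE.
by case: (ord2_cases i) => ->; case: (ord2_cases j) => ->; rewrite ?A01 ?A10 ?A00.
Qed.

(** The trace-free part of a 2 x 2 matrix A is determined by the triple
    [(A 0 1, A 1 0, A 1 1 - A 0 0)], and A commutes with B if and only if all
    2 x 2 minors of the two triples vanish.  If some entry of the triple of A is
    nonzero, it and the matching entry of the triple of B, up to sign, are the
    coefficients of a combination with zero triple; otherwise A is scalar. *)
Lemma comm_mx2_dependent (A B : 'M[F]_2) : A *m B = B *m A ->
  exists a b c, ((a != 0) || (b != 0)) /\ a *: A + b *: B = c%:M.
Proof.
move=> AB.
have E i j : \sum_k A i k * B k j = \sum_k B i k * A k j.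
  by move/matrixP/(_ i j): AB; rewrite !mxE.
have E00 : A 0 1 * B 1 0 = B 0 1 * A 1 0.
  by have := E 0 0; rewrite !sum_ord2 (mulrC (A 0 0)) => /addrI.
have E01 : (A 1 1 - A 0 0) * B 0 1 = (B 1 1 - B 0 0) * A 0 1.
  have := E 0 1; rewrite !sum_ord2 => /eqP; rewrite -subr_eq0 => /eqP e.
  by apply/eqP; rewrite -subr_eq0 -oppr_eq0; apply/eqP; rewrite -[RHS]e; ring.
have E10 : (A 1 1 - A 0 0) * B 1 0 = (B 1 1 - B 0 0) * A 1 0.
  have := E 1 0; rewrite !sum_ord2 => /eqP; rewrite -subr_eq0 => /eqP e.
  by apply/eqP; rewrite -subr_eq0; apply/eqP; rewrite -[RHS]e; ring.
have cross s t : s * A 0 1 = t * B 0 1 -> s * A 1 0 = t * B 1 0 ->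
    s * (A 1 1 - A 0 0) = t * (B 1 1 - B 0 0) -> t != 0 ->
    exists a b c, ((a != 0) || (b != 0)) /\ a *: A + b *: B = c%:M.
  move=> e01 e10 e11 t0; exists s, (- t), (s * A 0 0 - t * B 0 0).
  split; first by rewrite oppr_eq0 t0 orbT.
  rewrite [LHS]mx2_is_scalar ?mxE ?mulNr ?e01 ?e10 ?subrr//.
  apply/eqP; rewrite -subr_eq0 -oppr_eq0; apply/eqP.
  move/eqP: e11; rewrite -subr_eq0 => /eqP e.
  by rewrite -[RHS]e; ring.
have [A01|A01] := eqVneq (A 0 1) 0; last first.
  apply: (cross (B 0 1) (A 0 1)) => //; first exact: mulrC.
  by rewrite mulrC E01 mulrC.
have [A10|A10] := eqVneq (A 1 0) 0; last first.
  apply: (cross (B 1 0) (A 1 0)) => //; last by rewrite mulrC E10 mulrC.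
    by rewrite mulrC E00 mulrC.
  exact: mulrC.
have [A11|A11] := eqVneq (A 1 1 - A 0 0) 0; last first.
  apply: (cross (B 1 1 - B 0 0) (A 1 1 - A 0 0)) => //; exact: mulrC.
exists 1, 0, (A 0 0); rewrite oner_neq0 scale1r scale0r addr0; split=> //.
by apply: mx2_is_scalar => //; apply/eqP; rewrite eq_sym -subr_eq0 A11.
Qed.

Lemma span_plane m n (K : 'M[F]_(m, n)) (u v w : 'rV[F]_n) :
  \rank K = 2%N -> (u <= K)%MS -> (v <= K)%MS -> (w <= K)%MS ->
  u != 0 -> ~~ (v <= u)%MS -> exists a b, w = a *: u + b *: v.
Proof.
move=> rK uK vK wK u0 vu.
have uvK : (u + v <= K)%MS by rewrite addsmx_sub uK.
have : (w <= u + v)%MS.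
  apply: submx_trans wK _; rewrite -(geq_leqif (mxrank_leqif_sup uvK)) rK.
  apply: leq_trans (_ : (\rank u < \rank (u + v)%MS)%N).
    by rewrite rank_rV u0.
  by rewrite ltn_neqAle mxrankS ?addsmxSl// andbT;
    rewrite (mxrank_leqif_sup (addsmxSl u v)) addsmx_sub submx_refl.
by move=> /sub_addsmxP[[a b] ->]; exists (a 0 0), (b 0 0);
  rewrite /= -!mul_scalar_mx -!mx11_scalar.
Qed.

Lemma plane_complement m n (K : 'M[F]_(m, n)) (u : 'rV[F]_n) :
  \rank K = 2%N -> exists2 v : 'rV[F]_n, (v <= K)%MS & ~~ (v <= u)%MS.
Proof.
move=> rK; have : ~~ (K <= u)%MS.
  by apply/negP => /mxrankS; rewrite rK rank_rV; case: (u != 0).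
by move=> /row_subPn[i iu]; exists (row i K) => //; exact: row_sub.
Qed.

Lemma free2E n (u v : 'rV[F]_n) :
  free [:: v; u] = (u != 0) && ~~ (v <= u)%MS.
Proof.
rewrite free_cons seq1_free span_seq1 andbC; congr (_ && ~~ _).
by apply/vlineP/sub_rVP.
Qed.

(** K stands for the normal plane, given by its generating rows, and W for the
    map sending a normal vector to the matrix of its Weingarten operator. *)
Section WeingartenPencil.
Context {m n : nat}.
Variables (K : 'M[F]_(m, n)) (W : {linear 'rV[F]_n -> 'M[F]_2}).
Hypothesis rK : \rank K = 2%N.

Lemma scalar_direction_comm (N M M' : 'rV[F]_n) :
  N != 0 -> (N <= K)%MS -> is_scalar_mx (W N) ->
  (M <= K)%MS -> (M' <= K)%MS -> W M *m W M' = W M' *m W M.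
Proof.
move=> N0 NK /is_scalar_mxP[c WN] MK M'K.
have [L LK LN] := plane_complement N rK.
have [a [b ->]] := span_plane rK NK LK MK N0 LN.
have [a' [b' ->]] := span_plane rK NK LK M'K N0 LN.
rewrite !linearD !linearZ /= WN !scale_scalar_mx !(mulmxDl, mulmxDr).
rewrite !mul_scalar_mx !mul_mx_scalar -!scalemxAl.
by apply/matrixP => i j; rewrite !mxE; ring.
Qed.

Lemma comm_scalar_direction (M N : 'rV[F]_n) :
  free [:: M; N] -> (M <= K)%MS -> (N <= K)%MS ->
  W M *m W N = W N *m W M ->
  exists L, [/\ L != 0, (L <= K)%MS & is_scalar_mx (W L)].
Proof.
rewrite free2E => /andP[N0 MN] MK NK.
move=> /comm_mx2_dependent[a [b [c [ab abc]]]].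
exists (a *: M + b *: N); split.
- apply: contraNN MN => /eqP; have [a0|a0] := eqVneq a 0.
    move: ab; rewrite a0 eqxx scale0r add0r /= => b0 /eqP.
    by rewrite scaler_eq0 (negbTE b0) (negbTE N0).
  move=> /eqP; rewrite addr_eq0 => /eqP aM; apply/sub_rVP.
  exists (- (a^-1 * b)); rewrite scaleNr -scalerA -scalerN -aM.
  by rewrite scalerA mulVf// scale1r.
- by rewrite addmx_sub// scalemx_sub.
- by apply/is_scalar_mxP; exists c; rewrite linearD !linearZ.
Qed.

Lemma two_scalar_directions (N N' M : 'rV[F]_n) :
  N != 0 -> (N <= K)%MS -> is_scalar_mx (W N) ->
  ~~ (N' <= N)%MS -> (N' <= K)%MS -> is_scalar_mx (W N') ->
  (M <= K)%MS -> is_scalar_mx (W M).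
Proof.
move=> N0 NK /is_scalar_mxP[c WN] NN' N'K /is_scalar_mxP[c' WN'] MK.
have [a [b ->]] := span_plane rK NK N'K MK N0 NN'.
apply/is_scalar_mxP; exists (a * c + b * c').
by rewrite linearD !linearZ /= WN WN' !scale_scalar_mx -raddfD.
Qed.

End WeingartenPencil.
End LinearAlgebra.

(** * Gram matrices *)

Lemma mulmx_tr_eq0 (R : pzRingType) n (r : 'rV[R]_n) :
  (forall X : 'rV[R]_n, (r *m X^T) 0 0 = 0) -> r = 0.
Proof.
move=> r0; apply/rowP => j; have := r0 (delta_mx 0 j).
by rewrite trmx_delta -colE !mxE.
Qed.

Section InnerProduct.
Context {R : realType} {n : nat}.

Lemma ipDl (G : 'M[R]_n) (v v' w : 'rV[R]_n) :
  ip G (v + v') w = ip G v w + ip G v' w.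
Proof. by rewrite /ip !mulmxDl mxE. Qed.

Lemma ipZl (G : 'M[R]_n) (c : R) (v w : 'rV[R]_n) :
  ip G (c *: v) w = c * ip G v w.
Proof. by rewrite /ip -!scalemxAl mxE. Qed.

Lemma ip_sumr (G : 'M[R]_n) (v : 'rV[R]_n) (I : finType) (w : I -> 'rV[R]_n) :
  ip G v (\sum_a w a) = \sum_a ip G v (w a).
Proof. by rewrite /ip linear_sum mulmx_sumr summxE. Qed.

Lemma ipZr (G : 'M[R]_n) (c : R) (v w : 'rV[R]_n) :
  ip G v (c *: w) = c * ip G v w.
Proof. by rewrite /ip linearZ -scalemxAr mxE. Qed.

Lemma ip_sym (G : 'M[R]_n) (v w : 'rV[R]_n) : G^T = G ->
  ip G v w = ip G w v.
Proof.
move=> sG; rewrite /ip.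
have -> : v *m G *m w^T = (w *m G *m v^T)^T by rewrite !trmx_mul trmxK sG mulmxA.
by rewrite mxE.
Qed.

End InnerProduct.

Lemma lorentzian_unit (R : realType) (G : 'M[R]_4) : lorentzian G -> G \in unitmx.
Proof.
move=> [_ [P _ PG]]; have : Defs.minkowski R \in unitmx.
  rewrite unitmxE det_diag unitfE; apply/prodf_neq0 => i _.
  by rewrite mxE; case: ifP; rewrite ?oppr_eq0 oner_neq0.
by rewrite -PG !unitmx_mul => /andP[/andP[]].
Qed.

Lemma posdef_unit (R : realType) n (Q : 'M[R]_n) :
  (forall X : 'rV[R]_n, X != 0 -> 0 < (X *m Q *m X^T) 0 0) -> Q \in unitmx.
Proof.
move=> pQ; rewrite -row_free_unit; apply: inj_row_free => X XQ.
apply/eqP; apply: contraTT isT => /pQ.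
by rewrite XQ mul0mx mxE ltxx.
Qed.

(** * Weingarten operators of a spacelike surface *)

Section CovLinear.
Context {R : realType} {m n : nat}.

Lemma connection_linear (L L' : {linear 'rV[R]_m -> 'rV[R]_n})
    (C : 'I_n -> 'I_n -> 'I_n -> R) (w : 'rV[R]_n) :
  linear (fun X => L X + \row_k \sum_i \sum_j C i j k * L' X 0 i * w 0 j).
Proof.
move=> a X Y; rewrite !linearP scalerDr addrACA; congr (_ + _).
apply/rowP => k; rewrite !mxE mulr_sumr -big_split; apply: eq_bigr => i _ /=.
rewrite mulr_sumr -big_split; apply: eq_bigr => j _ /=.
rewrite !mxE; ring.
Qed.

Variables (G : 'rV[R]_n -> 'M[R]_n) (phi F : 'rV[R]_m -> 'rV[R]_n).

Lemma cov_linear p : differentiable F p -> linear (fun X => cov G phi F X p).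
Proof.
move=> dF; have -> : (fun X => cov G phi F X p) = (fun X => 'd F p X +
    \row_k \sum_i \sum_j
      christoffel G (phi p) i j k * ('d phi p X) 0 i * F p 0 j).
  by apply/funext => X; rewrite /cov (deriveE _ dF).
exact: (connection_linear ('d F p) ('d phi p) (christoffel G (phi p))).
Qed.

Lemma cov_sum_delta (X p : 'rV[R]_m) : differentiable F p ->
  cov G phi F X p = \sum_a X 0 a *: cov G phi F (delta_mx 0 a) p.
Proof.
move=> dF; pose covM := GRing.isLinear.Build _ _ _ _ _ (cov_linear dF).
pose covL : {linear _ -> _} := HB.pack (fun Y => cov G phi F Y p) covM.
rewrite -[LHS]/(covL X) [X in covL X]row_sum_delta linear_sum.
by apply: eq_bigr => a _; rewrite linearZ.
Qed.

End CovLinear.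

Section Geometry.
Context {R : realType} {V : lorentzian_manifold R} {S : smooth_manifold R 2}.
Variable f : S -> V.
Hypothesis f_immersion : immersion f.
Hypothesis f_spacelike : spacelike f.
Variable x : S.

Local Notation i := (chart_at (f x)).
Local Notation j := (chart_at x).
Local Notation loc := (loc f x).
Local Notation locmetric := (locmetric f x).
Local Notation pt := (pt x).

(** The coordinate domain on which [loc] is an honest coordinate representation
    of f. *)
Definition locdom : set 'rV[R]_2 :=
  cimg (achart j) `&` (f \o cinv (achart j)) @^-1` cdom (achart i).

Lemma chart_at_dom (n : nat) (M : smooth_manifold R n) (y : M) :
  cdom (achart (chart_at y)) y.
Proof. by rewrite /chart_at; case: cid. Qed.

Lemma locdom_pt : locdom pt.
Proof.
split; first exact/cmap_img/chart_at_dom.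
by rewrite /= /pt cmapK; exact: chart_at_dom.
Qed.

Lemma locdom_open : open locdom.
Proof.
have [fc _] := f_immersion.
have cc : {in cimg (achart j), continuous (cinv (achart j))}.
  by rewrite -continuous_open_subspace; [exact: cinv_cont|exact: cimg_open].
rewrite openE => u [uI uD]; apply: filterI.
  by apply: open_nbhs_nbhs; split => //; exact: cimg_open.
have : {for u, continuous (f \o cinv (achart j))}.
  by apply: continuous_comp; [apply: cc; rewrite inE|exact: fc].
apply; apply: open_nbhs_nbhs; split => //; exact: cdom_open.
Qed.

Lemma loc_img u : locdom u -> cimg (achart i) (loc u).
Proof. by move=> [_ uD]; exact: cmap_img. Qed.

Lemma loc_smooth : smooth_on locdom loc.
Proof. by have [_ /(_ i j)[]] := f_immersion. Qed.

Lemma loc_differentiable u : locdom u -> differentiable loc u.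
Proof. exact: (loc_smooth [::]). Qed.

Lemma dlocE u X : 'd loc u X = X *m jacobian loc u.
Proof. by rewrite mul_rV_lin1. Qed.

Lemma locmetric_lorentzian u : locdom u -> lorentzian (locmetric (loc u)).
Proof. by move=> uD; apply: lmetric_lorentzian; exact: loc_img. Qed.

Definition gram u : 'M[R]_2 :=
  jacobian loc u *m locmetric (loc u) *m (jacobian loc u)^T.

Lemma gram_sym u : locdom u -> (gram u)^T = gram u.
Proof.
by move=> /locmetric_lorentzian[sG _]; rewrite !trmx_mul trmxK sG mulmxA.
Qed.

Lemma gram_unit u : locdom u -> gram u \in unitmx.
Proof.
move=> [uI uD]; apply: posdef_unit => X X0.
have := f_spacelike uI uD X0; rewrite /ip -/loc -/locmetric !dlocE.
by rewrite trmx_mul /gram !mulmxA.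
Qed.

(** Its columns are the covectors dual to the coordinate frame of the surface,
    so that normality is membership in its left kernel. *)
Definition conormal u : 'M[R]_(4, 2) := locmetric (loc u) *m (jacobian loc u)^T.

Lemma normal_atP u N : normal_at f x u N <-> N *m conormal u = 0.
Proof.
have E X : gat f x u N ('d loc u X) = (N *m conormal u *m X^T) 0 0.
  by rewrite /gat /ip dlocE trmx_mul !mulmxA.
split=> [H|H X]; first by apply: mulmx_tr_eq0 => X; rewrite -E; exact: H.
by rewrite E H mul0mx mxE.
Qed.

Lemma gramE u : jacobian loc u *m conormal u = gram u.
Proof. by rewrite mulmxA. Qed.

(** A vector has only one tangential part, because two of them differ by some Y
    with [Y *m gram = 0]; this pins down the chosen one. *)
Lemma tangE v : tang f x v = v *m conormal pt *m invmx (gram pt).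
Proof.
have uq := gram_unit locdom_pt.
have nE Y : normal f x (v - 'd loc pt Y) <-> v *m conormal pt = Y *m gram pt.
  split=> [/normal_atP|vY].
    by rewrite dlocE mulmxBl -mulmxA gramE => /eqP; rewrite subr_eq0 => /eqP.
  by apply/normal_atP; rewrite dlocE mulmxBl -mulmxA gramE vY subrr.
rewrite /tang; set P := (X in xget 0 X).
have : P (xget 0 P).
  apply: xgetPex; exists (v *m conormal pt *m invmx (gram pt)).
  by apply/nE; rewrite mulmxKV.
by rewrite {1}/P /= => /nE ->; rewrite mulmxK.
Qed.

(** The orthogonal projection of the constant field N onto the normal spaces;
    it extends N smoothly when N is normal at the base point. *)
Definition normal_part (N : 'rV[R]_4) u : 'rV[R]_4 :=
  N - N *m conormal u *m invmx (gram u) *m jacobian loc u.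

Lemma jacobian_diffn k : diffn k locdom (fun u => jacobian loc u).
Proof.
apply/(diffn_mxP locdom_open) => a b.
have /smooth_onP/(_ k.+1)[_ /(_ (delta_mx 0 a))] := loc_smooth.
move=> /(diffn_mxP locdom_open)/(_ 0 b).
apply: (diffn_eq locdom_open) => u /set_mem uD.
by rewrite deriveE ?dlocE -?rowE ?mxE//; exact: loc_differentiable.
Qed.

Lemma locmetric_diffn k : diffn k locdom (fun u => locmetric (loc u)).
Proof.
have oD := locdom_open.
have /smooth_onP/(_ k)/(diffn_mxP (@cimg_open _ _ _ _)) dG := @lmetric_smooth _ V i.
have /smooth_onP/(_ k) dl := loc_smooth.
apply/(diffn_mxP oD) => a b.
apply: (@diffn_comp _ _ _ _ (cimg (achart i)) k loc
  (fun q => locmetric q a b)) => //.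
exact: loc_img.
Qed.

Lemma normal_part_field N : normal f x N -> normal_field f x (normal_part N).
Proof.
move=> nN; have oD := locdom_open; exists locdom; split.
- exact: oD.
- exact: locdom_pt.
- apply/smooth_onP => k; apply: (diffnD oD); first exact: (diffn_cst oD).
  have dJ := jacobian_diffn k.
  have dC : diffn k locdom conormal.
    by apply: (diffn_mulmx oD) (locmetric_diffn k) _; exact: (diffn_trmx oD).
  have dE : diffn k locdom
      (fun u => N *m conormal u *m invmx (gram u) *m jacobian loc u).
    apply: (diffn_mulmx oD) => //; apply: (diffn_mulmx oD).
      by apply: (diffn_mulmx oD) => //; exact: (diffn_cst oD).
    apply: (diffn_invmx oD); first exact: gram_unit.
    apply: (diffn_eq oD) (diffn_mulmx oD dJ dC) => u _; exact: gramE.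
  apply: (diffn_eq oD) (diffn_mulmx oD (diffn_cst oD k (-1)%:M) dE) => u _.
  by rewrite mul_scalar_mx scaleN1r.
- move=> u uD; apply/normal_atP.
  rewrite /normal_part mulmxBl.
  by rewrite -[X in _ - X]mulmxA gramE mulmxKV ?subrr//; exact: gram_unit.
Qed.

Lemma normal_extensionP N : normal f x N ->
  normal_field f x (normal_extension f x N) /\ normal_extension f x N pt = N.
Proof.
move=> nN; apply: (@xgetPex _ _ [set F | normal_field f x F /\ F pt = N]).
exists (normal_part N); split; first exact: normal_part_field.
move/normal_atP : nN => nN.
by rewrite /normal_part nN !mul0mx subr0.
Qed.

Definition frame_field (b : 'I_2) u : 'rV[R]_4 := 'd loc u (delta_mx 0 b).

Lemma frame_field_differentiable b : differentiable (frame_field b) pt.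
Proof.
have oD := locdom_open.
apply: (diffn_differentiable (k := 0) locdom_pt).
apply: (diffn_eq oD)
  (diffn_mulmx oD (diffn_cst oD 0 (delta_mx 0 b)) (jacobian_diffn 0)).
by move=> u _; rewrite /frame_field dlocE.
Qed.

(** The bilinear form [g(N, II(X, Y))] for N normal: pairing with such an N
    absorbs the normal projection in the definition of II. *)
Definition second_form (N : 'rV[R]_4) : 'M[R]_2 := \matrix_(a, b)
  - gat f x pt N (nabla f x (frame_field b) (delta_mx 0 a)).

Definition weingarten_mx N : 'M[R]_2 := second_form N *m invmx (gram pt).

Lemma frame_dual (v : 'rV[R]_4) b :
  (v *m conormal pt) 0 b = gat f x pt v (frame_field b pt).
Proof.
by rewrite /gat /ip /frame_field dlocE trmx_mul !mulmxA trmx_delta -colE [RHS]mxE.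
Qed.

(** The function [g(F, e_b)] vanishes identically near the base point, and metric
    compatibility splits its derivative into these two terms. *)
Lemma nabla_normal_tangential F X b : normal_field f x F ->
  gat f x pt (nabla f x F X) (frame_field b pt) =
  - gat f x pt (F pt) (nabla f x (frame_field b) X).
Proof.
move=> [U [oU Upt sF nF]].
have dF : differentiable F pt by exact: (sF [::]).
have lpt := loc_img locdom_pt.
have dG : differentiable locmetric (loc pt).
  exact: (@lmetric_smooth _ V i [::]).
have sG : \forall q \near loc pt, (locmetric q)^T = locmetric q.
  near=> q; have [] // : lorentzian (locmetric q).
  apply: lmetric_lorentzian; near: q; apply: open_nbhs_nbhs.
  by split => //; exact: cimg_open.
have uG := lorentzian_unit (locmetric_lorentzian locdom_pt).
have [_] := is_derive_ip dG (loc_differentiable locdom_pt) sG uG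
  (@diff_derivable _ _ _ _ _ X dF)
  (@diff_derivable _ _ _ _ _ X (frame_field_differentiable b)).
have -> : 'D_X (fun u => ip (locmetric (loc u)) (F u) (frame_field b u)) pt = 0.
  rewrite -(derive_cst (0 : R) pt X); apply: near_eq_derive; near=> u.
  by apply: nF; near: u; exact: open_nbhs_nbhs.
by move=> /esym/eqP; rewrite addr_eq0 => /eqP.
Unshelve. all: by end_near. Qed.

(** The tangent vector [A_N X] is recovered, through the inverse Gram matrix,
    from its products with the coordinate frame, and these involve the chosen
    extension of N only through its value at the base point. *)
Lemma weingartenE N X : normal f x N ->
  weingarten f x N X = X *m weingarten_mx N.
Proof.
move=> /normal_extensionP[nF Fpt]; rewrite /weingarten /weingarten_field tangE.
rewrite [RHS]mulmxA; congr (_ *m _); apply/rowP => b.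
rewrite frame_dual nabla_normal_tangential// Fpt mxE.
rewrite /nabla (cov_sum_delta _ _ X (frame_field_differentiable b)).
rewrite /gat ip_sumr -sumrN; apply: eq_bigr => a _.
by rewrite ipZr mxE mulrN.
Qed.

Lemma weingarten_mx_linear : linear weingarten_mx.
Proof.
move=> a M N; rewrite /weingarten_mx scalemxAl -mulmxDl; congr (_ *m _).
by apply/matrixP => b c; rewrite !mxE /gat ipDl ipZl opprD mulrN.
Qed.

Lemma shapeE N a b : normal f x N ->
  gat f x pt N (Defs.shape f x (delta_mx 0 a) (delta_mx 0 b)) = second_form N a b.
Proof.
move=> nN; have [sG _] := locmetric_lorentzian locdom_pt.
rewrite mxE /Defs.shape -/(frame_field b) /perp /gat ip_sym// opprB ipDl -scaleN1r ipZl.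
rewrite ip_sym// -[X in X + _]/(gat f x pt N _) nN add0r mulN1r.
by rewrite ip_sym.
Qed.

Lemma induced_metricE : induced_metric f x = gram pt.
Proof.
apply/matrixP => a b; rewrite mxE -[LHS]/(gat f x pt _ (frame_field b pt)).
by rewrite -frame_dual dlocE -mulmxA gramE -rowE mxE.
Qed.

(** As the Gram matrix q is symmetric, contracting [second_form N] with its
    inverse is taking the trace of [second_form N *m invmx q]. *)
Lemma mean_curvatureE N : normal f x N ->
  gat f x pt (mean_curvature f x) N = \tr (weingarten_mx N).
Proof.
move=> nN; have [sG _] := locmetric_lorentzian locdom_pt.
rewrite /gat ip_sym// /mean_curvature induced_metricE ip_sumr.
apply: eq_bigr => a _; rewrite mxE ip_sumr; apply: eq_bigr => b _.
rewrite ipZr -/(gat f x pt _ _) shapeE// mulrC; congr (_ * _).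
by rewrite -[in LHS](gram_sym locdom_pt) -trmx_inv mxE.
Qed.

(** The scalar is automatically half the trace, which is the mean curvature
    coefficient. *)
Lemma umbilical_alongP N :
  umbilical_along f x N <-> normal f x N /\ is_scalar_mx (weingarten_mx N).
Proof.
split=> [[nN uN]|[nN /is_scalar_mxP[c Wc]]]; split=> //.
  apply/is_scalar_mxP; eexists; apply/row_matrixP => a.
  by rewrite !rowE -weingartenE// uN mul_mx_scalar.
move=> X; rewrite weingartenE// mean_curvatureE// Wc mxtrace_scalar mul_mx_scalar.
by congr (_ *: _); field.
Qed.

(** The conormal matrix has rank 2 because its product with the Jacobian is the
    invertible Gram matrix. *)
Lemma rank_normal : \rank (kermx (conormal pt)) = 2%N.
Proof.
rewrite mxrank_ker; suff -> : \rank (conormal pt) = 2%N by [].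
apply/eqP; rewrite eqn_leq rank_leq_col /=.
rewrite -[X in (X <= _)%N](mxrank_unit (gram_unit locdom_pt)) -gramE.
exact: mxrankM_maxr.
Qed.

Lemma normalP N : reflect (normal f x N) (N <= kermx (conormal pt))%MS.
Proof. by apply: (iffP sub_kermxP) => /(normal_atP pt N). Qed.

Lemma weingarten_commuteP M N : normal f x M -> normal f x N ->
  weingarten_commute f x M N <->
  weingarten_mx M *m weingarten_mx N = weingarten_mx N *m weingarten_mx M.
Proof.
move=> nM nN; split=> [MN|MN X]; last first.
  by rewrite !weingartenE// -[LHS]mulmxA -[RHS]mulmxA MN.
apply/row_matrixP => a; rewrite !rowE [LHS]mulmxA [RHS]mulmxA.
by have := MN (delta_mx 0 a); rewrite !weingartenE// => ->.
Qed.

End Geometry.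

(** * Umbilical directions and commuting Weingarten operators *)

Theorem theorem1 (R : realType) (V : lorentzian_manifold R)
    (S : smooth_manifold R 2) (f : S -> V)
    (f_immersion : immersion f) (f_spacelike : spacelike f) :
  [/\ umbilical_along_normal_direction f <-> two_weingarten_commute f,
      two_weingarten_commute f <-> all_weingarten_commute f &
      umbilical_along_normal_direction f ->
      forall x : S, ~ totally_umbilical f x -> umbilical_direction_unique f x].
Proof.
pose W x : {linear 'rV[R]_4 -> 'M[R]_2} :=
  HB.pack (weingarten_mx f x)
    (GRing.isLinear.Build _ _ _ _ _ (weingarten_mx_linear f x)).
have rK x := rank_normal f_spacelike x.
have commP x M N := @weingarten_commuteP _ _ _ _ f_immersion f_spacelike x M N.
have umbP x N := umbilical_alongP f_immersion f_spacelike x N.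
have i_iii : umbilical_along_normal_direction f -> all_weingarten_commute f.
  move=> u x M N nM nN; have [L L0 /umbP[nL WL]] := u x.
  by apply/commP => //;
    apply: (@scalar_direction_comm _ _ _ _ (W x) (rK x) L) => //;
    exact/normalP.
have iii_ii : all_weingarten_commute f -> two_weingarten_commute f.
  move=> c x; have [N nN N0] : exists2 N, normal f x N & N != 0.
    (* a vector outside the line spanned by 0 is a nonzero one *)
    have [N /normalP nN N0] := plane_complement 0 (rK x).
    by exists N => //; apply: contraNneq N0 => ->; exact: sub0mx.
  have [M /normalP nM MN] := plane_complement N (rK x).
  by exists M, N; split; [exact: nM|exact: nN|rewrite free2E N0|exact: c].
have ii_i : two_weingarten_commute f -> umbilical_along_normal_direction f.
  move=> c x; have [M [N [nM nN fMN /commP MN]]] := c x.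
  have /normalP MK := nM; have /normalP NK := nN.
  have [L [L0 /normalP nL WL]] :=
    @comm_scalar_direction _ _ _ _ (W x) M N fMN MK NK (MN nM nN).
  by exists L => //; apply/umbP.
split; [split=> [/i_iii/iii_ii|/ii_i]//|split=> [/ii_i/i_iii|/iii_ii]//|].
move=> u x ntu; have [N N0 uN] := u x; exists N; split=> // N' N'0 uN'.
have /umbP[nN WN] := uN; have /umbP[nN' WN'] := uN'.
have [/sub_rVP[c N'E]|NN'] := boolP (N' <= N)%MS.
  by exists c => //; apply: contraNneq N'0 => c0; rewrite N'E c0 scale0r.
case: ntu => M nM; apply/umbP; split=> //.
by apply: (@two_scalar_directions _ _ _ _ (W x) (rK x) N N') => //;
  exact/normalP.
Qed.
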